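(* Let $d,K\ge 1$ be integers, $\mathbb X\subseteq\mathbb R^d$, $x_0\in\mathbb R^d$, $\delta\ge 0$, and let $c:\mathbb R^d\times\mathbb R^d\to[0,\infty)$ be continuous. For each $k\in\{1,\dots,K\}$ let $\hat\theta_k\in\mathbb R^d$, let $\hat\Sigma_k$ be a symmetric positive definite $d\times d$ matrix, and let $\rho_k\ge 0$. Let $\hat p\in\mathbb R_+^K$ with $\sum_{k=1}^K\hat p_k=1$. Then the problem $$\inf_{x\in\mathbb X}\ \sup_{\mathbb Q\in\mathcal B(\hat{\mathbb P})}\mathbb Q(\tilde\theta^\top x\le 0)\quad\text{s.t.}\quad c(x,x_0)\le\delta,\quad \sup_{\mathbb Q_k\in\mathcal B_k(\hat{\mathbb P}_k)}\mathbb Q_k(\tilde\theta^\top x\le 0)<1\ \ \forall k\in\{1,\dots,K\}$$ is equivalent to the finite-dimensional problem $$\inf_{x\in\mathcal X}\ \sum_{k=1}^K\hat p_k\, f_k(x)^2,$$ where $$\mathcal X=\left\{x\in\mathbb X:\ c(x,x_0)\le\delta,\ \ -\hat\theta_k^\top x+\rho_k\|x\|_2<0\ \ \forall k\in\{1,\dots,K\}\right\}$$ and $$f_k(x)=\frac{\rho_k\,\hat\theta_k^\top x\,\|x\|_2+\sqrt{x^\top\hat\Sigma_k x}\,\sqrt{(\hat\theta_k^\top x)^2+x^\top\hat\Sigma_k x-\rho_k^2\|x\|_2^2}}{(\hat\theta_k^\top x)^2+x^\top\hat\Sigma_k x}.$$ Here equivalence means that the feasible set of the first problem is exactly $\mathcal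 X$ and that the two objective functions coincide at every $x\in\mathcal X$.
   Context: $\tilde\theta$ denotes a random vector in $\mathbb R^d$ (the identity map on $\mathbb R^d$ under a probability distribution on $\mathbb R^d$); it is the parameter of a linear classifier, and the event that $x$ receives the unfavorable label is identified with $\{\tilde\theta^\top x\le 0\}$. Gelbrich distance: for $(\theta,\Sigma),(\hat\theta,\hat\Sigma)\in\mathbb R^d\times\mathbb S_+^d$ ($\mathbb S_+^d$ is the set of symmetric positive semidefinite $d\times d$ matrices), $$\mathbb G((\theta,\Sigma),(\hat\theta,\hat\Sigma))=\sqrt{\|\theta-\hat\theta\|_2^2+\mathrm{Tr}\big[\Sigma+\hat\Sigma-2(\hat\Sigma^{1/2}\Sigma\hat\Sigma^{1/2})^{1/2}\big]}.$$ Write $\mathbb Q_k\sim(\theta_k,\Sigma_k)$ if the probability distribution $\mathbb Q_k$ on $\mathbb R^d$ has mean $\theta_k$ and covariance matrix $\Sigma_k$. The nominal component $\hat{\mathbb P}_k$ has mean $\hat\theta_k$ and covariance $\hat\Sigma_k$, and $$\mathcal B_k(\hat{\mathbb P}_k)=\{\mathbb Q_k:\ \mathbb Q_k\sim(\theta_k,\Sigma_k),\ \mathbb G((\theta_k,\Sigma_k),(\hat\theta_k,\hat\Sigma_k))\le\rho_k\},$$ with no parametric form imposed on $\mathbb Q_k$. The mixture ambiguity set $\mathcal B(\hat{\mathbb P})$ is the set of all mixtures $\mathbb Q=\sum_{k=1}^K\hat p_k\mathbb Q_k$ with $\mathbb Q_k\in\mathcal B_k(\hat{\mathbb P}_k)$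 for all $k$. *)

(* Defs.v *)
From HB Require Import structures.
From mathcomp Require Import all_boot all_order all_algebra.
From mathcomp Require Import all_classical all_reals all_analysis.

Set Implicit Arguments.
Unset Strict Implicit.
Unset Printing Implicit Defensive.

Import Order.TTheory GRing.Theory Num.Theory.
Import numFieldNormedType.Exports.

Local Open Scope classical_set_scope.
Local Open Scope ring_scope.

Section LinearAlgebra.
Context {R : realType} {d : nat}.

Definition dotv (u v : 'cV[R]_d) : R := (u^T *m v) ord0 ord0.

(* The library norm on matrices is the max norm; this is the Euclidean one. *)
Definition norm2 (x : 'cV[R]_d) : R := Num.sqrt (dotv x x).

Definition quad (A : 'M[R]_d) (x : 'cV[R]_d) : R := (x^T *m A *m x) ord0 ord0.

Definition psd (A : 'M[R]_d) : Prop := A^T = A /\ forall x, 0 <= quad A x.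

Definition pd (A : 'M[R]_d) : Prop :=
  A^T = A /\ forall x, x != 0 -> 0 < quad A x.

(* For A positive semidefinite the set below is a singleton; on other
   matrices [psd_sqrt A] is 0. *)
Definition psd_sqrt (A : 'M[R]_d) : 'M[R]_d :=
  xget 0 [set B | psd B /\ B *m B = A].

Definition gelbrich (a b : 'cV[R]_d * 'M[R]_d) : R :=
  let S := psd_sqrt b.2 in
  Num.sqrt (norm2 (a.1 - b.1) ^+ 2
            + \tr (a.2 + b.2 - 2 *: psd_sqrt (S *m a.2 *m S))).

End LinearAlgebra.

(* R^d with its Borel sigma-algebra *)
Definition Rd (R : realType) (d : nat) :=
  g_sigma_algebraType (@open 'cV[R]_d).

Section Ambiguity.
Context {R : realType} {d : nat}.

Definition coord (i : 'I_d) (t : Rd R d) : R := (t : 'cV[R]_d) i ord0.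

(* Square integrability is part of the relation because the expectation and
   covariance operators of the library are total. *)
Definition has_moments (Q : probability (Rd R d) R)
    (m : 'cV[R]_d) (S : 'M[R]_d) : Prop :=
  [/\ forall i, coord i \in Lfun Q 2%:E,
      forall i, ('E_Q[coord i] = (m i ord0)%:E)%E
    & forall i j, covariance Q (coord i) (coord j) = (S i j)%:E].

Definition gelbrich_ball (mhat : 'cV[R]_d) (Shat : 'M[R]_d) (rho : R) :
    set (probability (Rd R d) R) :=
  [set Q | exists (m : 'cV[R]_d) (S : 'M[R]_d),
     has_moments Q m S /\ gelbrich (m, S) (mhat, Shat) <= rho].

Definition mixture_set {K : nat} (p : 'I_K -> R)
    (mhat : 'I_K -> 'cV[R]_d) (Shat : 'I_K -> 'M[R]_d) (rho : 'I_K -> R) :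
    set (probability (Rd R d) R) :=
  [set Q | exists Qs : 'I_K -> probability (Rd R d) R,
     (forall k, gelbrich_ball (mhat k) (Shat k) (rho k) (Qs k)) /\
     (forall A : set (Rd R d), measurable A ->
        Q A = (\sum_(k < K) (p k)%:E * Qs k A)%E)].

Definition unfavorable (x : 'cV[R]_d) : set (Rd R d) :=
  [set t | dotv t x <= 0].

Definition worst_case (B : set (probability (Rd R d) R)) (x : 'cV[R]_d) :
    \bar R :=
  ereal_sup [set (Q : probability (Rd R d) R) (unfavorable x) | Q in B].

Definition robust_feasible {K : nat} (X : set 'cV[R]_d) (x0 : 'cV[R]_d)
    (delta : R) (c : 'cV[R]_d -> 'cV[R]_d -> R) (mhat : 'I_K -> 'cV[R]_d)
    (Shat : 'I_K -> 'M[R]_d) (rho : 'I_K -> R) : set 'cV[R]_d :=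
  [set x | [/\ X x, c x x0 <= delta
    & forall k,
        (worst_case (gelbrich_ball (mhat k) (Shat k) (rho k)) x < 1)%E]].

Definition reduced_feasible {K : nat} (X : set 'cV[R]_d) (x0 : 'cV[R]_d)
    (delta : R) (c : 'cV[R]_d -> 'cV[R]_d -> R) (mhat : 'I_K -> 'cV[R]_d)
    (rho : 'I_K -> R) : set 'cV[R]_d :=
  [set x | [/\ X x, c x x0 <= delta
    & forall k, - dotv (mhat k) x + rho k * norm2 x < 0]].

Definition fk (m : 'cV[R]_d) (S : 'M[R]_d) (rho : R) (x : 'cV[R]_d) : R :=
  (rho * dotv m x * norm2 x
   + Num.sqrt (quad S x)
     * Num.sqrt (dotv m x ^+ 2 + quad S x - rho ^+ 2 * norm2 x ^+ 2))
  / (dotv m x ^+ 2 + quad S x).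

End Ambiguity.

(* Main.v *)
(* Projecting the Gelbrich ball on x gives the disc of radius rho |x| around
   (mhat^T x, sqrt (x^T Shat x)) in the half plane of pairs (mean, standard
   deviation): the trace in the distance is the squared Frobenius norm of the
   difference of two square roots of the covariances, so the disc contains the
   projection, and rank-one deformations of Shat reach its boundary.  For a
   positive mean a and standard deviation s Cantelli's inequality bounds the
   probability of the unfavorable event by s^2 / (s^2 + a^2), the squared sine
   of the angle of (a, s) with the first axis, and a finitely supported
   distribution attains it.  The worst case is thus the squared sine of the
   angle of the steepest tangent from the origin to the disc, which is fk^2; the
   tangent exists exactly when rho |x| < mhat^T x, and otherwise the mean can be
   made nonpositive and the worst case is 1. *)
Require Import Defs.
From HB Require Import structures.
From mathcomp Require Import all_boot all_order all_algebra.
From mathcomp Require Import all_classical all_reals all_analysis.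
From mathcomp Require Import measurable_realfun ring lra complex.
Import Order.TTheory GRing.Theory Num.Theory.
Import numFieldNormedType.Exports.
Local Open Scope classical_set_scope.
Local Open Scope ring_scope.

Set Implicit Arguments.
Unset Strict Implicit.

(** * Positive semidefinite matrices *)

Section EuclideanSpace.
Context {R : realType} {d : nat}.
Implicit Types (u v w x : 'cV[R]_d) (A B : 'M[R]_d).

Lemma dotvE u v : dotv u v = \sum_i u i ord0 * v i ord0.
Proof. by rewrite /dotv mxE; apply: eq_bigr => i _; rewrite mxE. Qed.

Lemma dotvC u v : dotv u v = dotv v u.
Proof. by rewrite !dotvE; apply: eq_bigr => i _; rewrite mulrC. Qed.

Lemma dotvDl u v w : dotv (u + v) w = dotv u w + dotv v w.
Proof. by rewrite /dotv linearD mulmxDl mxE. Qed.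

Lemma dotvZl (a : R) u v : dotv (a *: u) v = a * dotv u v.
Proof. by rewrite /dotv linearZ -scalemxAl mxE. Qed.

Lemma dotvNl u v : dotv (- u) v = - dotv u v.
Proof. by rewrite -scaleN1r dotvZl mulN1r. Qed.

Lemma dotvBl u v w : dotv (u - v) w = dotv u w - dotv v w.
Proof. by rewrite dotvDl dotvNl. Qed.

Lemma dotvDr u v w : dotv u (v + w) = dotv u v + dotv u w.
Proof. by rewrite dotvC dotvDl !(dotvC u). Qed.

Lemma dotvZr (a : R) u v : dotv u (a *: v) = a * dotv u v.
Proof. by rewrite dotvC dotvZl dotvC. Qed.

Lemma dotvNr u v : dotv u (- v) = - dotv u v.
Proof. by rewrite dotvC dotvNl dotvC. Qed.

Lemma dotvBr u v w : dotv u (v - w) = dotv u v - dotv u w.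
Proof. by rewrite dotvC dotvBl !(dotvC u). Qed.

Lemma dotv_sqr_ge0 v : 0 <= dotv v v.
Proof. by rewrite dotvE sumr_ge0// => i _; rewrite -expr2 sqr_ge0. Qed.

Lemma dotv_sqr_eq0 v : (dotv v v == 0) = (v == 0).
Proof.
apply/eqP/eqP => [|->]; last by rewrite dotvE big1// => i _; rewrite mxE mul0r.
rewrite dotvE => /eqP; rewrite psumr_eq0 => [/allP v0|i _]; last first.
  by rewrite -expr2 sqr_ge0.
apply/matrixP => i j; rewrite (ord1 j) mxE; apply/eqP.
by have := v0 i (mem_index_enum i); rewrite mulf_eq0 orbb.
Qed.

Lemma dotv_sqr_gt0 v : v != 0 -> 0 < dotv v v.
Proof. by move=> v0; rewrite lt_neqAle eq_sym dotv_sqr_eq0 v0 dotv_sqr_ge0. Qed.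

Lemma sqr_norm2 v : norm2 v ^+ 2 = dotv v v.
Proof. by rewrite sqr_sqrtr// dotv_sqr_ge0. Qed.

Lemma norm2_ge0 v : 0 <= norm2 v. Proof. exact: sqrtr_ge0. Qed.

Lemma norm2_gt0 v : v != 0 -> 0 < norm2 v.
Proof. by move=> v0; rewrite sqrtr_gt0 dotv_sqr_gt0. Qed.

Lemma CauchySchwarz_dotv u v : dotv u v ^+ 2 <= dotv u u * dotv v v.
Proof.
have [->|v0] := eqVneq v 0.
  by rewrite -[0 in X in X ^+ _](scale0r 0) dotvZr mul0r expr0n mulr_ge0// dotv_sqr_ge0.
have vv := dotv_sqr_gt0 v0.
have := dotv_sqr_ge0 (dotv v v *: u - dotv u v *: v).
rewrite dotvBl !dotvBr !dotvZl !dotvZr (dotvC v u).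
rewrite (_ : _ - _ = dotv v v * (dotv u u * dotv v v - dotv u v ^+ 2)); last by ring.
by rewrite pmulr_rge0// subr_ge0.
Qed.

Lemma dotv_mulmx A u v : dotv (A *m u) v = dotv u (A^T *m v).
Proof. by rewrite /dotv trmx_mul mulmxA. Qed.

Lemma quadE A x : quad A x = dotv x (A *m x).
Proof. by rewrite /quad /dotv mulmxA. Qed.

Lemma quadN A x : quad A (- x) = quad A x.
Proof. by rewrite !quadE mulmxN dotvNl dotvNr opprK. Qed.

Lemma quad_gram A x : quad (A^T *m A) x = dotv (A *m x) (A *m x).
Proof. by rewrite quadE -mulmxA -dotv_mulmx. Qed.

Lemma trace_gram A : \tr (A^T *m A) = \sum_i dotv (row i A)^T (row i A)^T.
Proof.
rewrite mxtrace_mulC; apply: eq_bigr => i _.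
by rewrite mxE dotvE; apply: eq_bigr => j _; rewrite !mxE.
Qed.

Lemma trace_gram_ge0 A : 0 <= \tr (A^T *m A).
Proof. by rewrite trace_gram sumr_ge0// => i _; exact: dotv_sqr_ge0. Qed.

(** The Frobenius norm dominates the operator norm: Cauchy-Schwarz is applied to each row of [A]. *)
Lemma quad_gram_le_trace A x : quad (A^T *m A) x <= \tr (A^T *m A) * dotv x x.
Proof.
rewrite quad_gram trace_gram mulr_suml dotvE ler_sum// => i _.
suff -> : (A *m x) i ord0 = dotv (row i A)^T x by exact: CauchySchwarz_dotv.
by rewrite mxE dotvE; apply: eq_bigr => j _; rewrite !mxE.
Qed.

Lemma sqr_subr_norm2_le u v :
  (norm2 u - norm2 v) ^+ 2 <= dotv (u - v) (u - v).
Proof.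
rewrite sqrrB !sqr_norm2 dotvBl !dotvBr (dotvC v u).
suff : dotv u v <= norm2 u * norm2 v by lra.
rewrite (le_trans (ler_norm _))// -[leLHS]sqrtr_sqr -sqrtrM ?dotv_sqr_ge0//.
by rewrite ler_wsqrtr// CauchySchwarz_dotv.
Qed.

Lemma psd_gram A : psd (A^T *m A).
Proof.
split; first by rewrite trmx_mul trmxK.
by move=> x; rewrite quad_gram dotv_sqr_ge0.
Qed.

Lemma pd_psd A : pd A -> psd A.
Proof.
move=> [At A0]; split=> // x; have [->|/A0/ltW//] := eqVneq x 0.
by rewrite quadE mulmx0 dotvE big1// => i _; rewrite mxE mul0r.
Qed.

Lemma pd_unitmx A : pd A -> A \in unitmx.
Proof.
move=> [At A0]; rewrite -row_free_unit -kermx_eq0; apply/eqP/row_matrixP => i.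
rewrite row0; apply/eqP/negPn/negP => ki0.
have /A0 : (row i (kermx A))^T != 0.
  by apply: contra ki0 => /eqP /(congr1 trmx); rewrite trmxK trmx0 => ->.
by rewrite /quad trmxK -row_mul mulmx_ker row0 mul0mx mxE ltxx.
Qed.

(** Along x + t A x the form is 2 t |A x|^2 + O(t^2), which is negative for small t < 0 unless A x =
    0. *)
Lemma psd_quad_eq0 A x : psd A -> quad A x = 0 -> A *m x = 0.
Proof.
move=> [At A0] qx.
pose w := A *m x.
have xAw : dotv x (A *m w) = dotv w w by rewrite -[in LHS]At -dotv_mulmx.
have h (t : R) : 0 <= 2 * t * dotv w w + t ^+ 2 * quad A w.
  have := A0 (x + t *: w); rewrite quadE mulmxDr -scalemxAr.
  rewrite dotvDl !dotvDr !dotvZl !dotvZr -!quadE qx xAw -/w.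
  move: (dotv w w) (quad A w) => a b.
  by rewrite (_ : _ + _ = 2 * t * a + t ^+ 2 * b)//; ring.
apply/eqP; rewrite -dotv_sqr_eq0 -/w.
have q0 := A0 w; have := dotv_sqr_ge0 w.
move: (dotv w w) (quad A w) h q0 => a b h b0 a0.
have b1 : 0 < 1 + b by rewrite ltr_pwDl.
(* Dividing by 1 + b instead of b keeps this choice of t valid when b = 0. *)
have := h (- a / (1 + b)).
rewrite (_ : _ + _ = - (a ^+ 2 * (2 + b) / (1 + b) ^+ 2)); last first.
  by field; rewrite gt_eqF.
rewrite oppr_ge0 pmulr_lle0 ?invr_gt0 ?exprn_gt0// pmulr_lle0 ?ltr_pwDl// => a2.
by rewrite -sqrf_eq0 eq_le a2 sqr_ge0.
Qed.

Lemma psd_conj A B : A^T = A -> psd B -> psd (A *m B *m A).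
Proof.
move=> At [Bt B0]; split; first by rewrite !trmx_mul At Bt mulmxA.
by move=> x; rewrite quadE -!mulmxA -{1}At -dotv_mulmx -quadE.
Qed.

Lemma quad_delta A i : quad A (delta_mx i ord0) = A i i.
Proof. by rewrite /quad trmx_delta -rowE -colE !mxE. Qed.

Lemma psd_trace_ge0 A : psd A -> 0 <= \tr A.
Proof. by move=> [_ A0]; rewrite sumr_ge0// => i _; rewrite -(quad_delta A). Qed.

(** Diagonal entries are values of the form at basis vectors, hence nonnegative; once they all
    vanish, [psd_quad_eq0] kills every column. *)
Lemma psd_trace_eq0 A : psd A -> \tr A = 0 -> A = 0.
Proof.
move=> psdA; have [_ A0] := psdA.
move=> /eqP; rewrite psumr_eq0 => [/allP tr0|i _]; last by rewrite -(quad_delta A).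
apply/matrixP => i j; rewrite mxE.
have /psd_quad_eq0 : quad A (delta_mx j ord0) = 0.
  by rewrite quad_delta; apply/eqP/tr0; exact: mem_index_enum.
by move=> /(_ psdA); rewrite -colE => /matrixP /(_ i ord0); rewrite !mxE.
Qed.

(* With D = A - B one has D (A + B) + (A + B) D = 2 (A^2 - B^2) = 0, so that
   the positive semidefinite matrices D A D and D B D have trace 0. *)
Lemma psd_sqrt_unique A B : psd A -> psd B -> A *m A = B *m B -> A = B.
Proof.
move=> psdA psdB eqAB; have [At _] := psdA; have [Bt _] := psdB.
have [D DE] : exists D, D = A - B by exists (A - B).
have Dt : D^T = D by rewrite DE linearB/= At Bt.
have pA : psd (D *m A *m D) by exact: psd_conj.
have pB : psd (D *m B *m D) by exact: psd_conj.
have trD : \tr (D *m A *m D) + \tr (D *m B *m D) = 0.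
  rewrite -linearD/= -mulmxDl -mulmxDr.
  have e : D *m (A + B) = - ((A + B) *m D).
    apply/eqP; rewrite -addr_eq0; apply/eqP.
    rewrite DE !(mulmxBl,mulmxBr,mulmxDl,mulmxDr) eqAB.
    by apply/matrixP=> i j; rewrite !mxE; ring.
  have : \tr (D *m (A + B) *m D) = - \tr (D *m (A + B) *m D).
    by rewrite {1}e mulNmx linearN/= mxtrace_mulC mulmxA.
  lra.
have DA0 : D *m A *m D = 0.
  by apply: psd_trace_eq0 => //; have := psd_trace_ge0 pA; have := psd_trace_ge0 pB; lra.
have DB0 : D *m B *m D = 0.
  by apply: psd_trace_eq0 => //; have := psd_trace_ge0 pA; have := psd_trace_ge0 pB; lra.
have D3 : D *m D *m D = 0.
  by rewrite {2}DE mulmxBr mulmxBl DA0 DB0 subrr.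
(* As [D] is symmetric, D^3 = 0 makes the Gram matrix of D^2 vanish, so D^2 = 0; the same argument
   then gives D = 0. *)
have D2 : (D *m D)^T *m (D *m D) = 0 by rewrite trmx_mul Dt mulmxA D3 mul0mx.
have {}D2 : D *m D = 0.
  apply/matrixP => i j; have := quad_gram (D *m D) (delta_mx j ord0).
  rewrite D2 quad_delta mxE => /esym/eqP; rewrite dotv_sqr_eq0 => /eqP.
  by rewrite -colE => /matrixP /(_ i ord0); rewrite !mxE.
apply/eqP; rewrite -subr_eq0 -DE; apply/eqP/matrixP => i j.
have := quad_gram D (delta_mx j ord0).
rewrite Dt D2 quad_delta mxE => /esym/eqP; rewrite dotv_sqr_eq0 => /eqP.
by rewrite -colE => /matrixP /(_ i ord0); rewrite !mxE.
Qed.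

End EuclideanSpace.

(** Newton's scheme: a new node is corrected by a multiple of the product that vanishes at all
    earlier ones. *)
Lemma poly_interpolation (F : fieldType) (s : seq F) (f : F -> F) :
  exists q : {poly F}, forall r, r \in s -> q.[r] = f r.
Proof.
elim: s => [|a s [q qs]]; first by exists 0.
have [as_|as_] := boolP (a \in s).
  by exists q => r; rewrite inE => /orP[/eqP ->|]; exact: qs.
pose w := \prod_(b <- s) ('X - b%:P).
have wa : w.[a] != 0 by rewrite -[_ == _]/(root w a) root_prod_XsubC.
exists (q + ((f a - q.[a]) / w.[a]) *: w) => r; rewrite hornerD hornerZ inE.
move=> /orP[/eqP ->|rs]; first by rewrite divfK// addrC subrK.
have -> : w.[r] = 0 by apply/eqP; rewrite -[_ == _]/(root w r) root_prod_XsubC.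
by rewrite mulr0 addr0 qs.
Qed.

Lemma trmx_horner_mx (F : comNzRingType) n (A : 'M[F]_n.+1) (q : {poly F}) :
  A^T = A -> (horner_mx A q)^T = horner_mx A q.
Proof.
move=> At; elim/poly_ind: q => [|q c IH].
  by rewrite rmorph0 trmx0.
rewrite rmorphD rmorphM /= horner_mx_X horner_mx_C linearD/= tr_scalar_mx.
congr (_ + _); rewrite -[in LHS]mulmxE trmx_mul IH At.
by rewrite mulmxE; apply/esym; exact: comm_horner_mx.
Qed.

Section PsdSquareRoot.
Context {R : realType}.
Local Notation C := (complex R).
Local Notation toC := (real_complex R).

Lemma psd_eigenvalue_ge0 n (A : 'M[R]_n) a : psd A -> eigenvalue A a -> 0 <= a.
Proof.
move=> [_ A0] /eigenvalueP[v vA v0].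
have vt0 : v^T != 0 by apply: contra v0 => /eqP/(congr1 trmx); rewrite trmxK trmx0 => ->.
have := A0 v^T; rewrite /quad trmxK vA -scalemxAl mxE.
rewrite (_ : (v *m v^T) _ _ = dotv v^T v^T) ?pmulr_lge0 ?dotv_sqr_gt0//.
by rewrite /dotv trmxK.
Qed.

Lemma map_toC_hermsymmx n (A : 'M[R]_n) :
  A^T = A -> map_mx toC A \is hermsymmx.
Proof.
move=> At; apply: realsym_hermsym.
  by apply/is_hermitianmxP; rewrite expr0 scale1r map_mx_id// map_trmx At.
by apply/mxOverP => i j; rewrite mxE; apply/complex_realP; exists (A i j).
Qed.

(* The square root is q(A)^2 for a real polynomial q taking the value t^(1/4)
   at every eigenvalue t of A: over the complex numbers A is unitarily
   diagonalizable with real eigenvalues, whence q(A)^4 = A. *)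
Lemma psd_sqrt_exists n (A : 'M[R]_n) :
  psd A -> exists B : 'M[R]_n, psd B /\ B *m B = A.
Proof.
case: n A => [|n] A psdA.
  exists A; split=> //; apply/matrixP => -[] //.
have [At _] := psdA.
have hA := map_toC_hermsymmx At.
have /orthomx_spectralP := hermitian_normalmx hA.
have /mxOverP spr := hermitian_spectral_diag_real hA.
have Pu := spectral_unit (map_mx toC A).
move: (spectralmx _) (spectral_diag _) Pu spr => P sp Pu spr AE.
have [r rE] : {r : 'I_n.+1 -> R & forall i, sp ord0 i = toC (r i)}.
  have /choice[f fE] : forall i, exists t, sp ord0 i = toC t.
    by move=> i; exact/complex_realP/spr.
  by exists f.
(* Row i of [P] is a complex eigenvector; since the characteristic polynomial is real, [r i] is an
   eigenvalue of [A] over the reals too. *)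
have r0 i : 0 <= r i.
  apply: (psd_eigenvalue_ge0 psdA).
  rewrite eigenvalue_root_char -(fmorph_root toC) map_char_poly.
  rewrite -eigenvalue_root_char; apply/eigenvalueP; exists (row i P).
    rewrite {1}AE !mulmxA -row_mul mulmxV// row1 -rowE row_diag_mx rE.
    by rewrite -scalemxAl -rowE.
  apply/eqP => Pi0; have := congr1 (mulmx^~ (invmx P)) Pi0.
  rewrite -row_mul mulmxV// row1 mul0mx => /matrixP /(_ ord0 i) /eqP.
  by rewrite !mxE !eqxx oner_eq0.
(* With fourth roots, the candidate root N^2 is the Gram matrix of the symmetric N = q(A), so it is
   visibly positive semidefinite. *)
have [q qE] := poly_interpolation (codom r) (fun t => Num.sqrt (Num.sqrt t)).
pose N := horner_mx A q.
have Nt : N^T = N by exact: trmx_horner_mx.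
exists (N *m N); split; first by rewrite -{1}Nt; exact: psd_gram.
have NE : N *m N *m (N *m N) = horner_mx A (q ^+ 4).
  by rewrite rmorphXn/= !mulmxE -!expr2 -exprM.
apply/eqP; rewrite NE -[X in _ == X](horner_mx_X A) -subr_eq0 -rmorphB/=.
apply/eqP/(map_mx_inj (f := toC)); rewrite map_mx0 map_horner_mx AE.
rewrite (horner_mx_uconjC _ _ Pu) horner_mx_diag (_ : map_mx _ _ = 0).
  by rewrite linear0 mulmx0 mul0mx.
apply/rowP => i; rewrite !mxE rE horner_map/= hornerD hornerN hornerX horner_exp.
rewrite qE ?codom_f// -[4%N]/(2 * 2)%N exprM sqr_sqrtr ?sqrtr_ge0// sqr_sqrtr//.
by rewrite subrr.
Qed.

End PsdSquareRoot.

Section PsdSqrt.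
Context {R : realType} {d : nat}.
Implicit Types (A B : 'M[R]_d).

Lemma psd_sqrtP A : psd A -> psd (psd_sqrt A) /\ psd_sqrt A *m psd_sqrt A = A.
Proof.
by move=> /psd_sqrt_exists[B BP]; exact: (@xgetPex _ _ [set B | psd B /\ B *m B = A]) (ex_intro _ B BP).
Qed.

Lemma psd_sqrtE A B : psd B -> B *m B = A -> psd_sqrt A = B.
Proof.
move=> psdB BB.
have [] : [set B | psd B /\ B *m B = A] (psd_sqrt A).
  by apply: xgetPex; exists B.
by move=> psdS SS; apply: psd_sqrt_unique => //; rewrite SS.
Qed.

End PsdSqrt.

(** * The Gelbrich distance along a direction *)

Section Gelbrich.
Context {R : realType} {d : nat}.
Implicit Types (m mu x : 'cV[R]_d) (S Sig Shat : 'M[R]_d).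

(* With S = Shat^(1/2) and M = (S Sig S)^(1/2), the trace in the Gelbrich
   distance is the squared Frobenius norm of N = M S^-1 - S, while the standard
   deviations along x are |M S^-1 x| and |S x|. *)
Lemma gelbrich_projection mu Sig m Shat (rho : R) x :
  pd Shat -> psd Sig -> gelbrich (mu, Sig) (m, Shat) <= rho ->
  (dotv mu x - dotv m x) ^+ 2
    + (Num.sqrt (quad Sig x) - Num.sqrt (quad Shat x)) ^+ 2
  <= rho ^+ 2 * norm2 x ^+ 2.
Proof.
move=> pdShat psdSig; rewrite /gelbrich /= sqr_norm2 => grho.
have [[St S0] SS] := psd_sqrtP (pd_psd pdShat).
set S := psd_sqrt Shat in St S0 SS grho.
have Su : S \in unitmx.
  by have := pd_unitmx pdShat; rewrite -SS unitmx_mul andbb.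
have [[Mt _] MM] := psd_sqrtP (psd_conj St psdSig).
set M := psd_sqrt (S *m Sig *m S) in Mt MM grho.
have Vt : (invmx S)^T = invmx S by rewrite trmx_inv St.
pose N := M *m invmx S - S.
have VMMV : invmx S *m M *m (M *m invmx S) = Sig.
  by rewrite !mulmxA -(mulmxA _ M M) MM -!mulmxA mulmxV// mulmx1 mulKmx.
have trN : \tr (N^T *m N) = \tr (Sig + Shat - 2 *: M).
  have -> : N^T = invmx S *m M - S by rewrite linearB/= trmx_mul Mt Vt St.
  rewrite mulmxBl !mulmxBr VMMV SS.
  rewrite !linearB/= linearD/= linearZ/=.
  rewrite (_ : \tr (invmx S *m M *m S) = \tr M); last first.
    by rewrite mxtrace_mulC mulmxA mulmxV// mul1mx.
  rewrite (_ : \tr (S *m (M *m invmx S)) = \tr M); last first.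
    by rewrite mxtrace_mulC -mulmxA mulVmx// mulmx1.
  by ring.
have {grho} : dotv (mu - m) (mu - m) + \tr (N^T *m N) <= rho ^+ 2.
  rewrite trN -[leLHS]sqr_sqrtr; last first.
    by rewrite -trN addr_ge0 ?dotv_sqr_ge0 ?trace_gram_ge0.
  by rewrite ler_pXn2r// nnegrE ?sqrtr_ge0// (le_trans _ grho)// sqrtr_ge0.
move=> /(ler_wpM2r (dotv_sqr_ge0 x)); rewrite sqr_norm2; apply: le_trans.
(* The mean part is Cauchy-Schwarz; the trace part dominates |N x|^2, to which the reverse triangle
   inequality applies. *)
rewrite mulrDl lerD//; first by rewrite -dotvBl CauchySchwarz_dotv.
apply: le_trans (quad_gram_le_trace N x).
have -> : Num.sqrt (quad Sig x) = norm2 (M *m invmx S *m x).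
  by rewrite /norm2 -(quad_gram (M *m invmx S)) trmx_mul Mt Vt VMMV.
have -> : Num.sqrt (quad Shat x) = norm2 (S *m x).
  by rewrite /norm2 -(quad_gram S) St SS.
by rewrite quad_gram mulmxBl sqr_subr_norm2_le.
Qed.

(* The extremal covariance matrix is T Shat T with T = 1 + kappa P, where P is
   the orthogonal projection onto the line of x. *)
Lemma gelbrich_witness m Shat (rho F G : R) x :
  pd Shat -> x != 0 -> 0 <= rho -> 0 <= G -> F ^+ 2 + G ^+ 2 <= 1 ->
  exists Sig, [/\ psd Sig,
    Num.sqrt (quad Sig x) = Num.sqrt (quad Shat x) + rho * norm2 x * G &
    gelbrich (m - (rho * F / norm2 x) *: x, Sig) (m, Shat) <= rho].
Proof.
move=> pdShat x0 rho0 G0 FG.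
have [[St S0] SS] := psd_sqrtP (pd_psd pdShat).
set S := psd_sqrt Shat in St S0 SS.
have [Shatt Shat0] := pdShat.
have xx := dotv_sqr_gt0 x0; have nx := norm2_gt0 x0.
have sx : 0 < Num.sqrt (quad Shat x) by rewrite sqrtr_gt0 Shat0.
have [P PE] : exists P, P = (dotv x x)^-1 *: (x *m x^T) by eexists.
have Pt : P^T = P by rewrite PE linearZ/= trmx_mul trmxK.
have xTx : x^T *m x = (dotv x x)%:M by rewrite [LHS]mx11_scalar.
have Px : P *m x = x.
  by rewrite PE -scalemxAl -mulmxA xTx mul_mx_scalar scalerA mulVf ?gt_eqF// scale1r.
(* [T] will scale x, and with it the standard deviation along x, by 1 + k; this k adds exactly rho
   |x| G to the latter. *)
pose k := rho * norm2 x * G / Num.sqrt (quad Shat x).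
have k0 : 0 <= k by rewrite !mulr_ge0 ?invr_ge0 ?norm2_ge0 ?sqrtr_ge0.
pose T := 1%:M + k *: P.
have Tt : T^T = T by rewrite linearD/= linearZ/= Pt trmx1.
have Tx : T *m x = (1 + k) *: x.
  by rewrite mulmxDl mul1mx -scalemxAl Px scalerDl scale1r.
have psdT : psd T.
  split=> // z; rewrite quadE mulmxDl mul1mx -scalemxAl dotvDr dotvZr addr_ge0//.
    exact: dotv_sqr_ge0.
  rewrite mulr_ge0// PE -scalemxAl dotvZr mulr_ge0 ?invr_ge0 ?(ltW xx)//.
  rewrite (_ : dotv z _ = dotv x z ^+ 2) ?sqr_ge0// -mulmxA.
  by rewrite [x^T *m z]mx11_scalar mul_mx_scalar dotvZr (dotvC z).
exists (T *m Shat *m T); split.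
- exact: psd_conj Tt (pd_psd pdShat).
- have -> : quad (T *m Shat *m T) x = (1 + k) ^+ 2 * quad Shat x.
    rewrite !quadE -!mulmxA Tx -{1}Tt -dotv_mulmx Tx.
    by rewrite -scalemxAr dotvZl dotvZr; ring.
  rewrite sqrtrM ?sqr_ge0// sqrtr_sqr ger0_norm ?addr_ge0// mulrDl mul1r.
  by rewrite /k divfK ?gt_eqF.
(* S T Shat T S = (S T S)^2, so the inner square root in the distance is S T S. *)
rewrite /gelbrich /= -/S (@psd_sqrtE _ _ _ (S *m T *m S)); first last.
- by rewrite -SS !mulmxA.
- exact: psd_conj St psdT.
have tr_STS : \tr (S *m T *m S) = \tr Shat + k * \tr (P *m Shat).
  rewrite mxtrace_mulC mulmxA SS mxtrace_mulC mulmxDl mul1mx -scalemxAl.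
  by rewrite linearD/= linearZ.
have tr_TShatT : \tr (T *m Shat *m T) =
    \tr Shat + 2 * k * \tr (P *m Shat) + k ^+ 2 * \tr (P *m Shat *m P).
  rewrite !(mulmxDl, mulmxDr) !mul1mx !mulmx1 -!scalemxAl -!scalemxAr.
  rewrite !linearD/= !linearZ/= (mxtrace_mulC Shat P).
  by ring.
have tr_PShatP : \tr (P *m Shat *m P) =
    Num.sqrt (quad Shat x) ^+ 2 / norm2 x ^+ 2.
  rewrite sqr_norm2 sqr_sqrtr ?ltW ?Shat0//.
  rewrite mxtrace_mulC mulmxA (_ : P *m P = P); last first.
    by rewrite {2}PE -scalemxAr mulmxA Px.
  rewrite PE -!scalemxAl linearZ/= mulrC; congr (_ * _).
  by rewrite mxtrace_mulC mulmxA /quad mxtrace_mulC mulmxA trace_mx11.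
(* The traces collapse to k^2 tr (P Shat P) = rho^2 G^2, and the shift of the mean contributes rho^2
   F^2. *)
rewrite linearB/= mxtraceD mxtraceZ tr_STS tr_TShatT tr_PShatP.
rewrite addrAC subrr add0r sqr_norm2 dotvNl dotvC dotvNl opprK dotvZl dotvZr.
rewrite (_ : _ + _ = rho ^+ 2 * (F ^+ 2 + G ^+ 2)); last first.
  by rewrite -sqr_norm2 /k; field; rewrite !gt_eqF.
rewrite -[leRHS](ger0_norm rho0) -sqrtr_sqr ler_wsqrtr//.
by rewrite ler_piMr ?sqr_ge0.
Qed.

End Gelbrich.

(** * Finite mixtures and finitely supported distributions *)

Section FiniteMixture.
Context {dT : measure_display} {T : measurableType dT} {R : realType}.
Context {I : finType}.

(** Passes between mixtures over a finite type and [msum], which sums an initial segment of a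
    sequence. *)
Lemma sum_nth_enum (V : nmodType) (i0 : I) (F : I -> V) :
  \sum_(k < #|I|) F (nth i0 (enum I) k) = \sum_i F i.
Proof.
rewrite -(big_mkord xpredT (fun k => F (nth i0 (enum I) k))) cardE.
by rewrite -(big_nth i0 xpredT F) big_enum.
Qed.

Lemma exists_mixture (w : I -> R) (Qs : I -> probability T R) :
  (forall i, 0 <= w i) -> \sum_i w i = 1 ->
  exists Q : probability T R,
    (forall A, Q A = \sum_i (w i)%:E * Qs i A)%E /\
    (forall f : T -> \bar R, measurable_fun [set: T] f ->
       (forall x, 0 <= f x)%E ->
       \int[Q]_x f x = \sum_i (w i)%:E * \int[Qs i]_x f x)%E.
Proof.
move=> w_ge0 w_sum1.
have [i0 _|noI] := pickP [pred _ : I | true]; last first.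
  by move: w_sum1; rewrite big_pred0// => /esym/eqP; rewrite oner_eq0.
pose term k : {measure set T -> \bar R} :=
  mscale (NngNum (w_ge0 (nth i0 (enum I) k))) (Qs (nth i0 (enum I) k)).
pose mu := msum term #|I|.
have muE A : (mu A = \sum_i (w i)%:E * Qs i A)%E.
  exact: (sum_nth_enum i0 (fun i => (w i)%:E * Qs i A)%E).
have mu1 : mu setT = 1%E.
  rewrite muE -w_sum1 -sumEFin; apply: eq_bigr => i _.
  by rewrite probability_setT mule1.
pose Q : probability T R := HB.pack mu (Measure_isProbability.Build _ _ _ mu mu1).
exists Q; split => // f mf f0.
rewrite [LHS]ge0_integral_measure_sum//.
rewrite -(sum_nth_enum i0 (fun i => (w i)%:E * \int[Qs i]_x f x)%E).
by apply: eq_bigr => k _; rewrite ge0_integral_mscale.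
Qed.

(** A mixture of Dirac masses; integrals of measurable functions become finite sums, whence square
    integrability. *)
Lemma exists_discrete (w : I -> R) (t : I -> T) :
  (forall i, 0 <= w i) -> \sum_i w i = 1 ->
  exists Q : probability T R,
    (forall A, Q A = (\sum_i w i * \1_A (t i))%:E) /\
    (forall f : T -> R, measurable_fun [set: T] f ->
       f \in Lfun Q 2%:E /\ ('E_Q[f] = (\sum_i w i * f (t i))%:E)%E).
Proof.
move=> w_ge0 w_sum1.
have [Q [QE Qint]] := exists_mixture (fun i => \d_(t i) : probability T R) w_ge0 w_sum1.
have Qint' (g : T -> R) : measurable_fun [set: T] g -> (forall x, 0 <= g x) ->
    (\int[Q]_x (g x)%:E = (\sum_i w i * g (t i))%:E)%E.
  move=> mg g0; rewrite Qint//; last exact/measurable_EFinP.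
  rewrite -sumEFin; apply: eq_bigr => i _.
  rewrite integral_dirac//; last exact/measurable_EFinP.
  by rewrite diracT mul1e.
exists Q; split => [A|f mf].
  by rewrite QE -sumEFin.
split.
  rewrite inE; apply/andP; split; rewrite inE//=.
  rewrite /finite_norm unlock /Lnorm poweR_lty//.
  rewrite Qint' ?ltry//.
  apply: (@measurableT_comp _ _ _ _ _ _ (@powR R ^~ 2)) => //.
  exact: measurableT_comp.
(* The formula is known for nonnegative functions only, so positive and negative parts are treated
   separately. *)
rewrite unlock integralE.
under eq_integral do rewrite funeposE -EFin_max.
under [X in (_ - X)%E]eq_integral do rewrite funenegE -EFinN -EFin_max.
rewrite Qint'; [|exact: measurable_funrpos|by move=> x; rewrite le_max lexx orbT].
rewrite Qint'; [|exact: measurable_funrneg|by move=> x; rewrite le_max lexx orbT].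
rewrite -EFinB -sumrB; congr EFin; apply: eq_bigr => i _.
rewrite -mulrBr; congr (_ * _).
by case: (leP (f (t i)) 0) => fi; case: (leP (- f (t i)) 0) => fi'; lra.
Qed.

End FiniteMixture.

(** * Borel measurability of linear functionals *)

Section Rd.
Context {R : realType} {d : nat}.

Lemma measurable_continuous_Rd (f : 'cV[R]_d -> R) :
  continuous f -> measurable_fun [set: Rd R d] (f : Rd R d -> R).
Proof.
move=> /continuousP cf; apply: (measurability _ (RGenOpens.measurableE R)).
move=> _ [_ [a [b ->] <-]]; rewrite setTI.
by apply: sub_sigma_algebra; exact/cf/interval_open.
Qed.

Lemma measurable_coord i : measurable_fun [set: Rd R d] (@Defs.coord R d i).
Proof.
apply: (@measurable_continuous_Rd (fun t => t i ord0)).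
exact: coord_continuous.
Qed.

Lemma coord_sum (x : 'cV[R]_d) (t : Rd R d) :
  dotv t x = \sum_i x i ord0 * Defs.coord i t.
Proof. by rewrite dotvE; apply: eq_bigr => i _; rewrite mulrC. Qed.

Lemma measurable_dotv (x : 'cV[R]_d) :
  measurable_fun [set: Rd R d] (fun t : Rd R d => dotv t x).
Proof.
under eq_fun do rewrite coord_sum.
by apply: measurable_sum => i; apply: measurable_funM => //; exact: measurable_coord.
Qed.

Lemma measurable_unfavorable (x : 'cV[R]_d) : measurable (unfavorable x).
Proof.
rewrite (_ : unfavorable x = [set: Rd R d] `&` (fun t : Rd R d => dotv t x) @^-1` `]-oo, 0]).
  by apply: measurable_dotv => //; exact: measurable_itv.
by rewrite setTI; apply/seteqP; split => t /=; rewrite in_itv.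
Qed.

End Rd.

(** * Moments of linear functionals *)

Section LinearCombination.
Context {dT : measure_display} {T : measurableType dT} {R : realType}.
Context (P : probability T R) {I : Type} (X : I -> T -> R).
Hypothesis X2 : forall i, X i \in Lfun P 2%:E.

Lemma Lfun2_Lfun1 (f : T -> R) : f \in Lfun P 2%:E -> f \in Lfun P 1.
Proof. by apply: Lfun_subset12; exact: fin_num_measure. Qed.

Lemma Lfun2_lincomb (s : seq I) (a : I -> R) :
  (fun t => \sum_(i <- s) a i * X i t) \in Lfun P 2%:E.
Proof.
elim: s => [|i s IH].
  by under eq_fun do rewrite big_nil; exact: Lfun_cst.
under eq_fun do rewrite big_cons.
have [|_] := @Lfun_submod_closed _ T R P 2%:E _; first by rewrite lee1n.
by move=> /(_ (a i) _ _ (X2 i) IH).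
Qed.

Lemma expectation_lincomb (s : seq I) (a : I -> R) :
  ('E_P[fun t => (\sum_(i <- s) a i * X i t)%R]
   = \sum_(i <- s) (a i)%:E * 'E_P[X i])%E.
Proof.
elim: s => [|i s IH].
  by under eq_fun do rewrite big_nil; rewrite big_nil (expectation_cst P 0).
under eq_fun do rewrite big_cons.
rewrite big_cons -IH -expectationZl ?Lfun2_Lfun1//.
rewrite -expectationD ?Lfun2_Lfun1//; last 2 first.
- by apply: Lfun_scale => //; rewrite ler1n.
- exact: Lfun2_lincomb.
by congr expectation; apply/funext => t /=; rewrite mulrC.
Qed.

Lemma covariance_lincombl (s : seq I) (a : I -> R) (Z : T -> R) :
  Z \in Lfun P 2%:E ->
  covariance P (fun t => \sum_(i <- s) a i * X i t) Z
  = (\sum_(i <- s) (a i)%:E * covariance P (X i) Z)%E.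
Proof.
move=> Z2; elim: s => [|i s IH].
  by under eq_fun do rewrite big_nil; rewrite big_nil (covariance_cst_l P 0).
under eq_fun do rewrite big_cons.
rewrite big_cons -IH -covarianceZl; [|exact: Lfun2_Lfun1..|exact: Lfun2_mul_Lfun1].
rewrite -covarianceDl//; first last.
- exact: Lfun2_lincomb.
- by apply: Lfun_scale => //; rewrite ler1n.
by congr covariance; apply/funext => t /=; rewrite mulrC.
Qed.

End LinearCombination.

Section Moments.
Context {R : realType} {d : nat}.
Context {Q : probability (Rd R d) R} {mu : 'cV[R]_d} {Sig : 'M[R]_d}.
Hypothesis QE : has_moments Q mu Sig.

Lemma dotv_lincomb (x : 'cV[R]_d) :
  (fun t : Rd R d => dotv t x) = fun t => \sum_i x i ord0 * Defs.coord i t.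
Proof. by apply/funext => t; exact: coord_sum. Qed.

Lemma Lfun2_dotv x : (fun t : Rd R d => dotv t x) \in Lfun Q 2%:E.
Proof. by rewrite dotv_lincomb; apply: Lfun2_lincomb; case: QE. Qed.

Lemma expectation_dotv x :
  ('E_Q[fun t : Rd R d => dotv t x] = (dotv mu x)%:E)%E.
Proof.
have [X2 Emu _] := QE.
rewrite dotv_lincomb expectation_lincomb// dotvC dotvE -sumEFin.
by apply: eq_bigr => i _; rewrite Emu.
Qed.

Lemma variance_dotv x :
  variance Q (fun t : Rd R d => dotv t x) = (quad Sig x)%:E.
Proof.
have [X2 _ Cov] := QE.
rewrite /variance {1}dotv_lincomb covariance_lincombl ?Lfun2_dotv//.
rewrite quadE dotvE -sumEFin; apply: eq_bigr => i _.
rewrite EFinM covarianceC dotv_lincomb covariance_lincombl// mxE -sumEFin.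
congr (_ * _)%E; apply: eq_bigr => j _.
by rewrite covarianceC Cov -EFinM mulrC.
Qed.

(** The quadratic form is a variance. [gelbrich_ball] does not ask for positivity of the covariance,
    which is recovered here. *)
Lemma has_moments_psd : psd Sig.
Proof.
split=> [|x]; last by rewrite -lee_fin -variance_dotv variance_ge0.
apply/matrixP => i j; rewrite mxE; apply/EFin_inj.
by have [_ _ Cov] := QE; rewrite -!Cov covarianceC.
Qed.

(** Cantelli's inequality for - theta^T x: the event says that it exceeds its mean by at least mu^T
    x. *)
Lemma unfavorable_le (x : 'cV[R]_d) : 0 < dotv mu x ->
  (Q (unfavorable x) <= (quad Sig x / (quad Sig x + dotv mu x ^+ 2))%:E)%E.
Proof.
move=> mux.
pose X : {RV Q >-> R} := HB.pack (fun t : Rd R d => dotv t (- x))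
  (@isMeasurableFun.Build _ _ _ _ _ (measurable_dotv (- x))).
have := @cantelli _ _ _ Q X (dotv mu x) (Lfun2_dotv _) mux.
rewrite (expectation_dotv (- x)) (variance_dotv (- x)) /=.
rewrite quadN dotvNr opprK; congr (Q _ <= _)%E.
by apply/seteqP; split=> t; rewrite /unfavorable/= -EFinD lee_fin dotvNr; lra.
Qed.

End Moments.

(** * Distributions attaining Cantelli's bound *)

Section ExtremalDistribution.
Context {R : realType} {d : nat}.
Implicit Types (mu x : 'cV[R]_d) (Sig : 'M[R]_d).

(* The component of a centered vector with covariance Sig that is uncorrelated
   with its projection on x has covariance Sig - (Sig x)(Sig x)^T / (x^T Sig x),
   which is again positive semidefinite and annihilates x. *)
Lemma residual_factorization Sig x : psd Sig -> 0 < quad Sig x ->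
  exists W : 'M[R]_d, (forall i, dotv (col i W) x = 0) /\
    forall i j, \sum_k W i k * W j k =
      Sig i j - (Sig *m x) i ord0 * (Sig *m x) j ord0 / quad Sig x.
Proof.
move=> psdSig sx.
have [Sigt _] := psdSig.
have [[Bt _] BB] := psd_sqrtP psdSig.
set B := psd_sqrt Sig in Bt BB.
have [S SE] : exists S, S = Sig - (quad Sig x)^-1 *: ((Sig *m x) *m (Sig *m x)^T).
  by eexists.
have quadS z : quad S z = quad Sig z - dotv z (Sig *m x) ^+ 2 / quad Sig x.
  rewrite SE quadE mulmxBl dotvBr -quadE -scalemxAl dotvZr; congr (_ - _).
  rewrite mulrC; congr (_ / _); rewrite -(mulmxA (Sig *m x)).
  by rewrite [(Sig *m x)^T *m z]mx11_scalar mul_mx_scalar dotvZr -/(dotv _ _) (dotvC _ z).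
have quadB z : quad Sig z = dotv (B *m z) (B *m z) by rewrite -quad_gram Bt BB.
have psdS : psd S.
  split.
    by rewrite SE linearB/= linearZ/= trmx_mul trmxK Sigt.
  move=> z; rewrite quadS subr_ge0 ler_pdivrMr// !quadB.
  rewrite -BB -mulmxA -{1}Bt -dotv_mulmx.
  exact: CauchySchwarz_dotv.
have [[Wt _] WW] := psd_sqrtP psdS.
set W := psd_sqrt S in Wt WW.
have Wsym i j : W i j = W j i by rewrite -{1}Wt mxE.
exists W; split=> [i|i j].
  (* |W x|^2 = x^T S x = s - s^2 / s with s = x^T Sig x. *)
  have /eqP : dotv (W *m x) (W *m x) = 0.
    by rewrite -quad_gram Wt WW quadS -quadE expr2 mulfK ?subrr// gt_eqF.
  rewrite dotv_sqr_eq0 => /eqP /matrixP /(_ i ord0).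
  rewrite mxE [RHS]mxE => Wx0; rewrite dotvE -[RHS]Wx0.
  by apply: eq_bigr => k _; rewrite mxE Wsym.
have -> : \sum_k W i k * W j k = (W *m W) i j.
  by rewrite mxE; apply: eq_bigr => k _; rewrite (Wsym j).
rewrite WW SE !mxE big_ord1 !mxE.
by congr (_ - _); rewrite mulrC.
Qed.

(* Along x the distribution is two-valued, as in the equality case of
   Cantelli's inequality; orthogonally to it the columns of W are taken with
   random signs. *)
Lemma exists_cantelli_extremal mu Sig x (eta : R) :
  psd Sig -> 0 < quad Sig x -> 0 < eta -> dotv mu x <= eta ->
  exists Q : probability (Rd R d) R, has_moments Q mu Sig /\
    ((quad Sig x / (quad Sig x + eta ^+ 2))%:E <= Q (unfavorable x))%E.
Proof.
move=> psdSig sx eta0 mux.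
have [W [Wx WW]] := residual_factorization psdSig sx.
set s := quad Sig x in sx WW *.
have [u uE] : exists u, u = Sig *m x by eexists.
rewrite -uE in WW.
have ux : dotv u x = s by rewrite uE dotvC -quadE.
have d_gt0 : (0 < d)%N.
  rewrite lt0n; apply: contraTneq sx => d0.
  rewrite /s quadE dotvE big1 ?ltxx// => i _.
  by have := ltn_ord i; rewrite {2}d0.
have dR : 0 < d%:R :> R by rewrite ltr0n.
pose r := Num.sqrt d%:R : R.
have rr : r ^+ 2 = d%:R by rewrite sqr_sqrtr// ltW.
have seta : 0 < s + eta ^+ 2 by rewrite addr_gt0// exprn_gt0.
(* Under the weights [q], [y] has mean 0 and variance s. As u^T x = s, the vector (y / s) u projects
   to y on x, and its covariance u u^T / s is the part missing from W W^T. *)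
pose q b := (if b then s else eta ^+ 2) / (s + eta ^+ 2).
pose y b := if b then - eta else s / eta.
pose w (k : 'I_d * (bool * bool)) := q k.2.1 / 2 / d%:R.
(* A column of [W] is drawn uniformly; the factor r = sqrt d offsets the weight 1 / d in the
   covariance. *)
pose t (k : 'I_d * (bool * bool)) : Rd R d :=
  mu + (y k.2.1 / s) *: u + ((if k.2.2 then 1 else -1) * r) *: col k.1 W.
have sum_index (F : 'I_d * (bool * bool) -> R) : \sum_k F k =
    \sum_i (F (i, (true, true)) + F (i, (true, false))
             + (F (i, (false, true)) + F (i, (false, false)))).
  rewrite (eq_bigr (fun k => F (k.1, k.2))) => [|[]//].
  rewrite -(pair_bigA _ (fun i p => F (i, p)))/=; apply: eq_bigr => i _.
  rewrite (eq_bigr (fun k => F (i, (k.1, k.2)))) => [|[]//].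
  by rewrite -(pair_bigA _ (fun a b => F (i, (a, b))))/= !big_bool.
have w_ge0 k : 0 <= w k.
  rewrite /w !divr_ge0 ?ler0n//; last exact: ltW.
  by case: (k.2.1); rewrite ?sqr_ge0 ?ltW.
have sum_cst (c : R) : \sum_(i < d) (c / d%:R) = c.
  by rewrite sumr_const card_ord -mulrnAr -mulr_natl mulfV ?mulr1 ?gt_eqF.
have w_sum1 : \sum_k w k = 1.
  rewrite sum_index -[RHS]sum_cst; apply: eq_bigr => i _.
  by rewrite /w /q /=; field; rewrite !gt_eqF.
have [Q [QE Qint]] := exists_discrete t w_ge0 w_sum1.
have tE i b e a : (t (i, (b, e)) : 'cV[R]_d) a ord0 =
    mu a ord0 + y b / s * u a ord0 + ((if e then 1 else -1) * r) * W a i.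
  by rewrite /t /= !mxE.
have EQ a : ('E_Q[Defs.coord a] = (mu a ord0)%:E)%E.
  have [_ ->] := Qint _ (measurable_coord a); congr EFin.
  rewrite sum_index -[RHS]sum_cst; apply: eq_bigr => i _.
  by rewrite /w /q /Defs.coord !tE /y /=; field; rewrite !gt_eqF.
exists Q; split.
  split=> [a|//|a b]; first by have [] := Qint _ (measurable_coord a).
  rewrite unlock !EQ /=.
  have [|_ ->] := Qint ((Defs.coord a \- cst (mu a ord0)) * (Defs.coord b \- cst (mu b ord0))).
    by apply: measurable_funM; apply: measurable_funB => //; exact: measurable_coord.
  congr EFin; rewrite sum_index.
  transitivity (\sum_i ((u a ord0 * u b ord0 / s) / d%:R + W a i * W b i)).
    apply: eq_bigr => i _; rewrite /w /q !fctE /Defs.coord /= !tE /y /= -rr.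
    by field; rewrite !gt_eqF// /r sqrtr_gt0.
  by rewrite big_split/= sum_cst WW addrC subrK.
rewrite QE lee_fin sum_index -[leLHS]sum_cst ler_sum// => i _.
(* These atoms project to mu^T x - eta <= 0, whatever the column and its sign. *)
have t_unf e : \1_(unfavorable x) (t (i, (true, e))) = 1 :> R.
  rewrite indicE mem_set// /unfavorable /= /t /= !dotvDl !dotvZl Wx mulr0 addr0.
  by rewrite ux divfK ?gt_eqF//; lra.
rewrite !t_unf !mulr1 -[leLHS]addr0 lerD//.
  rewrite le_eqVlt; apply/orP; left; apply/eqP.
  by rewrite /w /q /=; field; rewrite !gt_eqF.
by rewrite addr_ge0// mulr_ge0// indicE.
Qed.

End ExtremalDistribution.

(** * The worst case over a Gelbrich ball *)

(* Sine and cosine of the angle, measured from the first axis, of the steepest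
   tangent from the origin to the disc with center (a, s) and radius r. *)
Definition tangent_sin {R : realType} (a s r : R) : R :=
  (r * a + s * Num.sqrt (a ^+ 2 + s ^+ 2 - r ^+ 2)) / (a ^+ 2 + s ^+ 2).

Definition tangent_cos {R : realType} (a s r : R) : R :=
  (a * Num.sqrt (a ^+ 2 + s ^+ 2 - r ^+ 2) - s * r) / (a ^+ 2 + s ^+ 2).

Section TangentToDisc.
Context {R : realType} (a s r : R).
Hypotheses (r_ge0 : 0 <= r) (s_gt0 : 0 < s) (r_lt_a : r < a).
Local Notation q := (Num.sqrt (a ^+ 2 + s ^+ 2 - r ^+ 2)).
Local Notation F := (tangent_sin a s r).
Local Notation G := (tangent_cos a s r).

Let a_gt0 : 0 < a. Proof. exact: le_lt_trans r_lt_a. Qed.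

Let n_gt0 : 0 < a ^+ 2 + s ^+ 2. Proof. by rewrite addr_gt0 ?exprn_gt0. Qed.

Let sqr_q : q ^+ 2 = a ^+ 2 + s ^+ 2 - r ^+ 2.
Proof.
rewrite sqr_sqrtr// addrAC addr_ge0 ?sqr_ge0// subr_ge0.
by rewrite ler_pXn2r// ?nnegrE ltW.
Qed.

Let s_lt_q : s < q.
Proof.
have r2_lt_a2 : r ^+ 2 < a ^+ 2 by rewrite ltr_pXn2r// nnegrE ltW.
rewrite -[s in s < _](gtr0_norm s_gt0) -sqrtr_sqr ltr_sqrt; first by lra.
by have := exprn_gt0 2 s_gt0; lra.
Qed.

Lemma tangent_sin_gt0 : 0 < F.
Proof.
have q_gt0 : 0 < q := lt_trans s_gt0 s_lt_q.
by rewrite divr_gt0// ltr_wpDl ?(mulr_gt0 s_gt0)// mulr_ge0// ltW.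
Qed.

Lemma tangent_cos_gt0 : 0 < G.
Proof.
rewrite divr_gt0// subr_gt0 (@le_lt_trans _ _ (s * a))//.
  by rewrite ler_pM2l// ltW.
by rewrite mulrC ltr_pM2l.
Qed.

Lemma tangent_sin_cos : F ^+ 2 + G ^+ 2 = 1.
Proof.
rewrite (_ : _ + _ = (q ^+ 2 + r ^+ 2) / (a ^+ 2 + s ^+ 2)); last first.
  by rewrite /tangent_sin /tangent_cos; field; rewrite gt_eqF.
by rewrite sqr_q subrK divff// gt_eqF.
Qed.

(** The line through the origin with direction (G, F) passes at distance r from the center, that is,
    it is tangent. *)
Lemma tangent_distance : a * F - s * G = r.
Proof. by rewrite /tangent_sin /tangent_cos; field; rewrite gt_eqF. Qed.

(** The point of contact is (a - r F, s + r G); it lies on the line with direction (G, F). *)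
Lemma tangent_point : (s + r * G) * G = (a - r * F) * F.
Proof.
have -> : (s + r * G) * G = s * G + r * (F ^+ 2 + G ^+ 2) - r * F ^+ 2 by ring.
by rewrite tangent_sin_cos; have := tangent_distance; lra.
Qed.

Lemma tangent_point_gt0 : 0 < a - r * F.
Proof.
rewrite -(pmulr_lgt0 _ tangent_sin_gt0) -tangent_point.
by rewrite pmulr_lgt0 ?tangent_cos_gt0// ltr_pwDl// mulr_ge0// ltW// tangent_cos_gt0.
Qed.

Lemma tangent_point_ratio :
  (s + r * G) ^+ 2 / ((s + r * G) ^+ 2 + (a - r * F) ^+ 2) = F ^+ 2.
Proof.
have F0 := tangent_sin_gt0.
have s'0 : 0 < s + r * G by rewrite ltr_pwDl// mulr_ge0// ltW// tangent_cos_gt0.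
rewrite -[RHS]mulr1 -tangent_sin_cos.
rewrite (_ : a - r * F = (s + r * G) * G / F); last first.
  by rewrite tangent_point mulfK// gt_eqF.
move: (s + r * G) s'0 => u u0.
move: tangent_sin_cos F0; move: F G => f g fg f0.
rewrite (_ : _ + _ = u ^+ 2 * (f ^+ 2 + g ^+ 2) / f ^+ 2); last first.
  by field; rewrite gt_eqF.
by rewrite fg; field; rewrite !gt_eqF.
Qed.

(** The disc lies below the tangent: s' G - a' F equals - r at the center and varies by at most r
    over the disc. Squaring s' G <= a' F and using F^2 + G^2 = 1 gives the ratio. *)
Lemma disc_ratio_le (a' s' : R) : 0 <= s' ->
  (a' - a) ^+ 2 + (s' - s) ^+ 2 <= r ^+ 2 ->
  0 < a' /\ s' ^+ 2 / (s' ^+ 2 + a' ^+ 2) <= F ^+ 2.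
Proof.
move=> s'0 disc.
have a'0 : 0 < a'.
  have : (a' - a) ^+ 2 <= r ^+ 2 by have := sqr_ge0 (s' - s); lra.
  rewrite -ler_sqrt ?sqr_ge0// !sqrtr_sqr (ger0_norm r_ge0) ler_norml => /andP[].
  have := r_lt_a; lra.
split=> //.
have F0 := tangent_sin_gt0; have G0 := tangent_cos_gt0.
have FG := tangent_sin_cos; have dist := tangent_distance.
have le_aF : s' * G <= a' * F.
  suff : (s' - s) * G - (a' - a) * F <= r by lra.
  move: disc FG; move: (s' - s) (a' - a) F G => u v f g disc fg.
  rewrite -[leRHS](ger0_norm r_ge0) -sqrtr_sqr (le_trans (ler_norm _))//.
  rewrite -sqrtr_sqr ler_wsqrtr// (le_trans _ disc)//.
  rewrite -[leRHS]mulr1 -fg -subr_ge0.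
  rewrite (_ : _ - _ = (u * f + v * g) ^+ 2); first exact: sqr_ge0.
  by ring.
have sq_le : s' ^+ 2 * G ^+ 2 <= a' ^+ 2 * F ^+ 2.
  by rewrite -!exprMn ler_pXn2r// nnegrE mulr_ge0// ltW.
rewrite ler_pdivrMr; last by rewrite ltr_wpDl ?sqr_ge0// exprn_gt0.
by rewrite -[leLHS]mulr1 -FG; lra.
Qed.

End TangentToDisc.

Section GelbrichBall.
Context {R : realType} {d : nat}.
Variables (m : 'cV[R]_d) (Shat : 'M[R]_d) (rho : R).
Hypotheses (pdShat : pd Shat) (rho_ge0 : 0 <= rho).

Lemma fkE x : 0 <= quad Shat x ->
  fk m Shat rho x
  = tangent_sin (dotv m x) (Num.sqrt (quad Shat x)) (rho * norm2 x).
Proof.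
move=> s0; rewrite /fk /tangent_sin (sqr_sqrtr s0) exprMn.
by congr ((_ + _) / _); ring.
Qed.

(* The projection of Q on x has mean m^T x - rho |x| F and standard deviation
   sqrt (x^T Shat x) + rho |x| G. *)
Lemma gelbrich_ball_extremal x (F G eta : R) : x != 0 ->
  0 <= G -> F ^+ 2 + G ^+ 2 <= 1 ->
  0 < eta -> dotv m x - rho * norm2 x * F <= eta ->
  exists2 Q, gelbrich_ball m Shat rho Q &
    (((Num.sqrt (quad Shat x) + rho * norm2 x * G) ^+ 2
      / ((Num.sqrt (quad Shat x) + rho * norm2 x * G) ^+ 2 + eta ^+ 2))%:E
     <= Q (unfavorable x))%E.
Proof.
move=> x0 G0 FG eta0 mux.
have [_ Shat0] := pdShat.
have nx := norm2_gt0 x0.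
have [Sig [psdSig sE gel]] := gelbrich_witness m pdShat x0 rho_ge0 G0 FG.
have s_gt0 : 0 < Num.sqrt (quad Sig x).
  by rewrite sE ltr_pwDl ?sqrtr_gt0 ?Shat0// mulr_ge0// mulr_ge0// ltW.
have quad_gt0 : 0 < quad Sig x by rewrite -sqrtr_gt0.
have [|Q [QE Qge]] := exists_cantelli_extremal (mu := m - (rho * F / norm2 x) *: x)
    psdSig quad_gt0 eta0.
  rewrite dotvBl dotvZl -sqr_norm2 (_ : _ * _ = rho * norm2 x * F)//.
  by field; rewrite gt_eqF.
exists Q; last by rewrite -sE sqr_sqrtr// ltW.
by exists (m - (rho * F / norm2 x) *: x), Sig.
Qed.

Lemma gelbrich_ball_le_worst_case x Q : gelbrich_ball m Shat rho Q ->
  (Q (unfavorable x) <= worst_case (gelbrich_ball m Shat rho) x)%E.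
Proof. by move=> ballQ; apply: ereal_sup_ubound; exists Q. Qed.

(** Serves the case x = 0 below. Any nonzero direction will do, with F = G = 0 and a large enough
    eta. *)
Lemma gelbrich_ball_nonempty : (0 < d)%N -> exists Q, gelbrich_ball m Shat rho Q.
Proof.
move=> d_gt0; pose e : 'cV[R]_d := delta_mx (Ordinal d_gt0) ord0.
have e0 : e != 0.
  apply/eqP => /matrixP /(_ (Ordinal d_gt0) ord0) /eqP.
  by rewrite !mxE !eqxx oner_eq0.
have [|||Q ballQ _] := @gelbrich_ball_extremal e 0 0 (`|dotv m e| + 1) e0 (lexx _).
- by rewrite expr0n addr0.
- by rewrite ltr_wpDl.
- by rewrite mulr0 subr0 (le_trans (ler_norm _))// lerDl.
by exists Q.
Qed.

Section Feasible.
Variable x : 'cV[R]_d.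
Hypothesis x_feasible : - dotv m x + rho * norm2 x < 0.

Let x_neq0 : x != 0.
Proof.
apply: contraTneq x_feasible => ->; rewrite -leNgt.
by rewrite dotvC -[X in dotv X _](scale0r 0) dotvZl mul0r oppr0 add0r mulr_ge0// norm2_ge0.
Qed.

Let r_ge0 : 0 <= rho * norm2 x. Proof. by rewrite mulr_ge0// norm2_ge0. Qed.

Let quad_gt0 : 0 < quad Shat x. Proof. by case: pdShat => _; exact. Qed.

Let s_gt0 : 0 < Num.sqrt (quad Shat x). Proof. by rewrite sqrtr_gt0. Qed.

Let r_lt_a : rho * norm2 x < dotv m x.
Proof. by move: x_feasible; rewrite addrC subr_lt0. Qed.

Lemma gelbrich_ball_le_fk Q : gelbrich_ball m Shat rho Q ->
  (Q (unfavorable x) <= (fk m Shat rho x ^+ 2)%:E)%E.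
Proof.
move=> [mu [Sig [QE gel]]].
have psdSig := has_moments_psd QE.
have := gelbrich_projection x pdShat psdSig gel; rewrite -exprMn.
move=> /(disc_ratio_le r_ge0 s_gt0 r_lt_a (sqrtr_ge0 _))[mux].
have [_ Sig0] := psdSig.
rewrite sqr_sqrtr// => ratio.
rewrite (le_trans (unfavorable_le QE mux))// lee_fin fkE// ltW//.
Qed.

Lemma gelbrich_ball_attained : exists2 Q, gelbrich_ball m Shat rho Q &
  Q (unfavorable x) = (fk m Shat rho x ^+ 2)%:E.
Proof.
have G0 := tangent_cos_gt0 r_ge0 s_gt0 r_lt_a.
have FG : tangent_sin (dotv m x) (Num.sqrt (quad Shat x)) (rho * norm2 x) ^+ 2
    + tangent_cos (dotv m x) (Num.sqrt (quad Shat x)) (rho * norm2 x) ^+ 2 <= 1.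
  by rewrite tangent_sin_cos.
(* Taking eta equal to the projected mean a - r F puts (mean, deviation) at the point of contact. *)
have [Q ballQ Qge] := gelbrich_ball_extremal x_neq0 (ltW G0) FG
  (tangent_point_gt0 r_ge0 s_gt0 r_lt_a) (lexx _).
exists Q => //; apply/eqP; rewrite eq_le gelbrich_ball_le_fk//=.
by move: Qge; rewrite tangent_point_ratio// fkE// ltW.
Qed.

Lemma worst_case_gelbrich_ball_lt1 :
  (worst_case (gelbrich_ball m Shat rho) x < 1)%E.
Proof.
apply: (@le_lt_trans _ _ (fk m Shat rho x ^+ 2)%:E).
  by apply: ge_ereal_sup => _ [Q ballQ <-]; exact: gelbrich_ball_le_fk.
(* The bound is the squared sine, and the cosine is positive. *)
rewrite lte_fin fkE ?ltW//.
have := tangent_sin_cos r_ge0 s_gt0 r_lt_a.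
by have := exprn_gt0 2 (tangent_cos_gt0 r_ge0 s_gt0 r_lt_a); lra.
Qed.

End Feasible.

(* Here the mean can be shifted so that its projection on x is nonpositive;
   letting eta tend to 0 pushes the Cantelli bound to 1. *)
Lemma worst_case_gelbrich_ball_ge1 x : (0 < d)%N -> dotv m x <= rho * norm2 x ->
  (1 <= worst_case (gelbrich_ball m Shat rho) x)%E.
Proof.
move=> d_gt0 infeasible.
have [x0|x_neq0] := eqVneq x 0.
  have [Q ballQ] := gelbrich_ball_nonempty d_gt0.
  apply: le_trans (gelbrich_ball_le_worst_case _ ballQ).
  rewrite (_ : unfavorable x = setT) ?probability_setT//.
  apply/seteqP; split=> // t _; rewrite /unfavorable /= x0.
  by rewrite -[X in dotv _ X](scale0r 0) dotvZr mul0r.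
have quad_gt0 : 0 < quad Shat x by case: pdShat => _; exact.
have lb (eta : R) : 0 < eta ->
    ((quad Shat x / (quad Shat x + eta ^+ 2))%:E
     <= worst_case (gelbrich_ball m Shat rho) x)%E.
  move=> eta0.
  have [||Q ballQ] := @gelbrich_ball_extremal x 1 0 eta x_neq0 (lexx _) _ eta0.
  - by rewrite expr1n expr0n addr0.
  - by rewrite mulr1 (le_trans _ (ltW eta0))// subr_le0.
  rewrite mulr0 addr0 (sqr_sqrtr (ltW quad_gt0)) => Qge.
  exact: le_trans Qge (gelbrich_ball_le_worst_case _ ballQ).
rewrite leNgt; apply/negP => lt1.
(* The bound at eta = 1 excludes the value -oo, so the worst case is a real c < 1. *)
have := lb 1 ltr01; case: (worst_case _ _) lt1 lb => [c| |]//; rewrite lte_fin => c1 lb _.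
(* This eta turns the bound into 2 / (3 - c) <= c, that is (1 - c) (2 - c) <= 0, which is absurd. *)
have := lb (Num.sqrt (quad Shat x * ((1 - c) / 2))).
rewrite sqrtr_gt0 mulr_gt0 ?divr_gt0 ?subr_gt0// => /(_ isT).
rewrite sqr_sqrtr; last by rewrite mulr_ge0 ?divr_ge0 ?subr_ge0 ?ltW.
rewrite lee_fin (_ : _ / _ = 2 / (3 - c)); last first.
  by field; apply/andP; split; apply/eqP; nra.
by rewrite ler_pdivrMr; nra.
Qed.

End GelbrichBall.

(** * From single components to the mixture *)

Unset Implicit Arguments.
Set Strict Implicit.

Theorem theorem3p2 (R : realType) (d K : nat) (hd : (1 <= d)%N) (hK : (1 <= K)%N)
    (X : set 'cV[R]_d) (x0 : 'cV[R]_d) (delta : R) (hdelta : 0 <= delta)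
    (c : 'cV[R]_d -> 'cV[R]_d -> R)
    (hc0 : forall x y, 0 <= c x y)
    (hc : continuous (fun z : 'cV[R]_d * 'cV[R]_d => c z.1 z.2))
    (mhat : 'I_K -> 'cV[R]_d) (Shat : 'I_K -> 'M[R]_d) (rho : 'I_K -> R)
    (hShat : forall k, pd (Shat k)) (hrho : forall k, 0 <= rho k)
    (p : 'I_K -> R) (hp0 : forall k, 0 <= p k) (hp1 : \sum_(k < K) p k = 1) :
  robust_feasible X x0 delta c mhat Shat rho
    = reduced_feasible X x0 delta c mhat rho
  /\ forall x, reduced_feasible X x0 delta c mhat rho x ->
       worst_case (mixture_set p mhat Shat rho) x
         = (\sum_(k < K) p k * fk (mhat k) (Shat k) (rho k) x ^+ 2)%:E.
Proof.
split.
  apply/seteqP; split=> x [Xx cx feas]; split=> // k; last first.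
    exact: worst_case_gelbrich_ball_lt1.
  rewrite ltNge; apply/negP => infeas; have := feas k; apply/negP; rewrite -leNgt.
  by apply: worst_case_gelbrich_ball_ge1 => //; lra.
move=> x [Xx cx feas]; rewrite -sumEFin; apply/eqP; rewrite eq_le; apply/andP; split.
  apply: ge_ereal_sup => _ [Q [Qs [ballQs QE]] <-].
  rewrite QE; last exact: measurable_unfavorable.
  apply: lee_sum => k _; rewrite EFinM lee_wpmul2l ?lee_fin//.
  exact: gelbrich_ball_le_fk.
(* Each component attains its own worst case at x, and the mixture of these maximizers attains the
   weighted sum. *)
have /choice[Qs QsP] k : exists Q : probability (Rd R d) R,
    gelbrich_ball (mhat k) (Shat k) (rho k) Q /\
    Q (unfavorable x) = (fk (mhat k) (Shat k) (rho k) x ^+ 2)%:E.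
  have [Q ballQ QE] := gelbrich_ball_attained (hShat k) (hrho k) (feas k).
  by exists Q.
have [Q [QE _]] := exists_mixture Qs hp0 hp1.
apply: ereal_sup_ubound; exists Q.
  by exists Qs; split=> [k|A _]; [have [] := QsP k|exact: QE].
by rewrite QE; apply: eq_bigr => k _; have [_ ->] := QsP k.
Qed.
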